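(* Assume $\mathrm{add}(\mathcal{N})<\mathrm{cov}(\mathcal{M})\le\mathfrak{u}<\mathfrak{g}$. Then $$\mathrm{add}(\mathcal{N})<\mathrm{cf}(\mathrm{cov}(\mathcal{M}))=\mathrm{cov}(\mathcal{M})=\mathrm{add}(\mathsf{S}_1(\mathrm{O},\mathrm{O}))=\mathrm{add}(\mathsf{S}_1(\mathrm{B},\mathrm{B})).$$
   Context: All topological spaces are assumed to be Tychonoff. $\mathcal{M}$ and $\mathcal{N}$ are the families of meager and of Lebesgue null subsets of $\mathbb{R}$. $\mathrm{add}(\mathcal{N})$ is the minimal number of null sets whose union is not null; $\mathrm{cov}(\mathcal{M})$ is the minimal number of meager sets whose union is $\mathbb{R}$; $\mathrm{cf}$ denotes cofinality. $\mathfrak{u}$ is the minimal cardinality of a base of a nonprincipal ultrafilter on $\mathbb{N}$. A family $\mathcal{G}$ of infinite subsets of $\mathbb{N}$ is groupwise dense if it is closed under taking infinite almost-subsets (infinite $a$ with $a\setminus b$ finite for some $b\in\mathcal{G}$) and, for every partition of $\mathbb{N}$ into finite intervals, some union of infinitely many of these intervals is in $\mathcal{G}$; $\mathfrak{g}$ is the minimal number of groupwise dense families with empty intersection. A cover of a space $X$ is a family $\mathcal{U}$ with $X=\bigcup\mathcal{U}$ and $X\notin\mathcal{U}$. $\mathrm{O}(X)$ is the family of open covers of $X$, and $\mathrm{B}(X)$ is the family of countable Borel covers of $X$. For $\mathscr{A}\in\{\mathrm{O},\mathrm{B}\}$, $X$ satisfies $\mathsf{S}_1(\mathscr{A},\mathscr{A})$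 if for each sequence $\mathcal{U}_n\in\mathscr{A}(X)$, $n\in\mathbb{N}$, there are $U_n\in\mathcal{U}_n$ such that $\{U_n : n\in\mathbb{N}\}\in\mathscr{A}(X)$. ($\mathsf{S}_1(\mathrm{O},\mathrm{O})$ is Rothberger's property.) For a property $P$ of topological spaces, $\mathrm{add}(P)$ is the minimal number of spaces possessing the property $P$ whose union does not have the property $P$.
   Formalization: In add(S1(O,O)) the union is required to be Lindelöf, since a discrete space of size aleph_1 (a union of singletons) would otherwise refute the equality; in both additivity numbers the union is nonempty, as the empty space fails S1 with this notion of cover. *)

(* Defs.v *)
From HB Require Import structures.
From mathcomp Require Import all_boot all_order all_algebra.
From mathcomp Require Import all_classical all_reals all_analysis.

Set Implicit Arguments.
Unset Strict Implicit.
Unset Printing Implicit Defensive.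

Import Order.TTheory GRing.Theory Num.Theory.
Import numFieldNormedType.Exports.

Local Open Scope classical_set_scope.
Local Open Scope ring_scope.
Local Open Scope card_scope.

(* A cardinal is represented by the class of all types having that cardinality;
   two cardinals are the same iff these classes are (extensionally) equal.
   The empty class represents "undefined": no order relation holds of it. *)
Definition cardinal := Type -> Prop.

Definition cardinal_le (c d : cardinal) : Prop :=
  exists K L : Type, [/\ c K, d L & [set: K] #<= [set: L]].

Definition cardinal_lt (c d : cardinal) : Prop := cardinal_le c d /\ c <> d.

(* The least of the cardinalities of the types K satisfying C. Every C used
   below is invariant under equipotence. *)
Definition min_cardinal (C : Type -> Prop) : cardinal :=
  fun K => C K /\ forall L, C L -> [set: K] #<= [set: L].

Definition min_size (T : Type) (Phi : set (set T)) : cardinal :=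
  min_cardinal (fun K => exists2 F, Phi F & [set: K] #= F).

(* r well-orders K in the order type of the initial ordinal of |K|: every
   proper initial segment has fewer than |K| elements. *)
Definition initial_well_order (K : Type) (r : rel K) : Prop :=
  wochoice.well_order r /\
  forall x : K, ~~ ([set: K] #<= [set y | r y x /\ y <> x]).

Definition cofinal_in (K : Type) (r : rel K) (A : set K) : Prop :=
  forall x, exists2 y, A y & r x y.

Definition cofinality (c : cardinal) : cardinal :=
  min_cardinal (fun L => exists (K : Type) (r : rel K) (A : set K),
    [/\ c K, initial_well_order r, cofinal_in r A & [set: L] #= A]).

Definition nowhere_dense (T : topologicalType) (A : set T) : Prop :=
  interior (closure A) = set0.

Definition meager (T : topologicalType) (A : set T) : Prop :=
  exists2 F : nat -> set T,
    forall n, nowhere_dense (F n) & A = \bigcup_n F n.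

Definition lebesgue_null (R : realType) (A : set R) : Prop :=
  (@lebesgue_measure R).-negligible A.

Definition add_null (R : realType) : cardinal :=
  min_size [set F : set (set R) |
    F `<=` @lebesgue_null R /\ ~ lebesgue_null (\bigcup_(A in F) A)].

Definition cov_meager (R : realType) : cardinal :=
  min_size [set F : set (set R) |
    F `<=` @meager R /\ \bigcup_(A in F) A = setT].

Definition nonprincipal (U : set_system nat) : Prop :=
  forall n, U <> principal_filter n.

Definition ultrafilter_base (B : set (set nat)) (U : set_system nat) : Prop :=
  B `<=` U /\ forall A, U A -> exists2 b, B b & b `<=` A.

Definition ultrafilter_number : cardinal :=
  min_size [set B : set (set nat) | exists U : set_system nat,
    [/\ UltraFilter U, nonprincipal U & ultrafilter_base B U]].

Definition finite_interval (I : set nat) : Prop :=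
  exists m n : nat, I = [set k | (m <= k < n)%N].

Definition interval_partition (P : set (set nat)) : Prop :=
  partition P id setT /\ P `<=` finite_interval.

Definition groupwise_dense (G : set (set nat)) : Prop :=
  [/\ forall a, G a -> infinite_set a,
      forall a b, G b -> infinite_set a -> finite_set (a `\` b) -> G a &
      forall P, interval_partition P ->
        exists Q, [/\ Q `<=` P, infinite_set Q & G (\bigcup_(I in Q) I)]].

Definition groupwise_density_number : cardinal :=
  min_size [set F : set (set (set nat)) |
    F `<=` groupwise_dense /\ \bigcap_(G in F) G = set0].

Definition is_cover (X : Type) (U : set (set X)) : Prop :=
  \bigcup_(A in U) A = setT /\ ~ U setT.

Definition open_covers (X : topologicalType) : set (set (set X)) :=
  [set U | is_cover U /\ U `<=` open].

Definition borel_covers (X : topologicalType) : set (set (set X)) :=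
  [set U | [/\ is_cover U, countable U & U `<=` <<s @open X >>]].

Definition S1 (A B : forall X : topologicalType, set (set (set X)))
    (X : topologicalType) : Prop :=
  forall U : nat -> set (set X), (forall n, A X (U n)) ->
    exists2 V : nat -> set X, forall n, U n (V n) & B X (range V).

Definition tychonoff_space (X : topologicalType) : Prop :=
  completely_regular_space X /\ hausdorff_space X.

Definition lindelof_space (X : topologicalType) : Prop :=
  forall U : set (set X), U `<=` open -> \bigcup_(A in U) A = setT ->
    exists V, [/\ V `<=` U, countable V & \bigcup_(A in V) A = setT].

Definition tychonoff_lindelof_space (X : topologicalType) : Prop :=
  tychonoff_space X /\ lindelof_space X.

(* The least number of spaces having P whose union is a space in the class C
   not having P. The spaces whose union is taken are subspaces of that union:
   [set_type A] carries the subspace topology of X. Spaces are nonempty; X must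
   be required to be so since the empty space, whose only cover is the empty
   family, does not satisfy S1 and is the union of no spaces at all.

   C matters for S1 open_covers open_covers: this property implies the Lindelof
   property, so among all Tychonoff spaces the additivity number would be at
   most aleph_1, as shown by a discrete space of size aleph_1, the union of its
   singletons. Unions are therefore taken among Lindelof spaces in that case.
   No such restriction is needed for S1 borel_covers borel_covers, where covers
   are countable by definition. *)
Definition add_property (C P : topologicalType -> Prop) : cardinal :=
  min_cardinal (fun K => exists (X : topologicalType) (F : set (set X)),
    [/\ C X, [set: X] !=set0,
        forall A, F A -> P (set_type A),
        \bigcup_(A in F) A = setT &
        ~ P X /\ [set: K] #= F]).

Definition add_S1_open : cardinal :=
  add_property tychonoff_lindelof_space (S1 open_covers open_covers).

Definition add_S1_borel : cardinal :=
  add_property tychonoff_space (S1 borel_covers borel_covers).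

(* Main.v *)
Require Import Defs.
From mathcomp Require Import all_boot all_order all_algebra.
From mathcomp Require Import all_classical all_reals all_analysis.
From mathcomp Require Import lra.

Set Implicit Arguments.
Unset Strict Implicit.
Unset Printing Implicit Defensive.

Import Order.TTheory GRing.Theory Num.Theory.
Import numFieldNormedType.Exports.

(** It is enough to show that the cofinality of cov(M) and the two additivity
numbers equal cov(M); the strict inequality is then the assumption
add(N) < cov(M). Two facts about the
selection principle [selects O Y] carry the proof. It asks to choose, from
each of a sequence of countable covers of [Y] by members of [O], one set so
that every point of [Y] is caught infinitely often; for open or Borel sets it
is the combinatorial content of S_1.

First, the union of fewer than cov(M) sets that select also selects
([selects_bigcup]). Given covers of the union, each piece [F i] has its own
selection [f i], and a point [y] of [F i] yields the infinite set [A_y] of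
the [n] at which [f i] catches it. The key step is that u < g makes one
partition into finite intervals work for a whole selecting set: every [A_y]
meets all but finitely many intervals ([selects_Hurewicz], which is the
statement that Rothberger spaces are Hurewicz when u < g). Fewer than cov(M)
such partitions have a common coarsening with the same property, because an
index set of that size is itself selecting and the key step applies to it as
well. Finally, since the line is not a union of so few meager sets, a single
sequence agrees with the restrictions of all [f i] to the intervals
infinitely often ([not_cov_guessable]); it catches a given point of [F i] on
every late enough interval where it agrees with [f i].

The key step goes through a dichotomy for families [S] of subsets of nat
([meets_or_tracks]). Fix a base of fewer than g sets of an ultrafilter. For
each base set [B], consider the sets [a] such that some member of [S] lies,
up to finitely many points, in the union of the intervals cut out by [a]
that meet [B]. If for some [B] these [a] are not groupwise dense, then
all members of [S] meet almost all intervals of a coarsening of the partition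
that witnesses this.
Otherwise one [a] works for all [B], so that modulo [a] the family [S]
refines an ultrafilter. A selecting family cannot do this, because selection
allows one to build a union of intervals of [a] that splits all its members
([bicolor]).

Second, a cover of the line by cov(M) meager sets, coded by functions from
nat to nat, gives a subset of the Baire space of size at most cov(M) that does not
select ([meager_cover_not_selects]): if it did, the key step would bound the
codes, and a sequence guessing the bounded codes infinitely often would
describe nested intervals whose common point lies in no set of the cover.

The set just found is a Tychonoff Lindelof space that is the union of its
points, so both additivity numbers are at most cov(M); by the first fact they
are at least cov(M) ([add_S1_class]). If cov(M) had smaller cofinality, the
same set would be a union of fewer than cov(M) sets of size smaller than
cov(M); those select, and so would their union ([cov_le_cofinality]). *)


(** * Interval partitions and groupwise density *)

Local Open Scope classical_set_scope.
Local Open Scope nat_scope.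

Lemma infinite_natP (A : set nat) :
  infinite_set A <-> forall m, exists2 i, A i & m <= i.
Proof.
split=> [infA m|unbA finA].
  apply: contrapT => noA; apply: infA; apply: (@sub_finite_set _ _ `I_m).
    move=> i Ai; rewrite /= ltnNge; apply/negP => mi; apply: noA.
    by exists i.
  exact: finite_II.
have /finite_seqP[s sA] := finA.
have [N sN] : exists N, forall j, j \in s -> j < N.
  elim: s {sA} => [|k s [N IH]]; first by exists 0.
  exists (maxn k.+1 N) => j; rewrite inE leq_max => /predU1P[->|/IH ->].
    by rewrite leqnn.
  by rewrite orbT.
have [i Ai] := unbA N; rewrite leqNgt => /negP; apply; apply: sN.
by rewrite sA in Ai.
Qed.

Lemma incr_locate (x : nat -> nat) : (forall k, x k < x k.+1) ->
  forall i, x 0 <= i -> exists k, x k <= i < x k.+1.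
Proof.
move=> xS i x0i; have xge k : k <= x k.
  by elim: k => // k IH; exact: leq_ltn_trans IH (xS k).
have ex : exists k, i < x k by exists i.+1; exact: xge.
case: (ex_minnP ex) => -[|k] ik kmin; first by rewrite leqNgt ik in x0i.
by exists k; rewrite ik andbT leqNgt; apply/negP => /kmin; rewrite ltnn.
Qed.

Lemma incr_le (x : nat -> nat) : (forall k, x k < x k.+1) ->
  {homo x : k l / k <= l}.
Proof.
by move=> xS; apply: homo_leq => [n|n m p|n] //; [exact: leq_trans|exact: ltnW].
Qed.

(** The points of [a] are the left ends of a partition of nat into intervals;
two integers are linked when they lie in the same interval. *)
Definition linked (a : set nat) (i j : nat) : Prop :=
  forall c, a c -> (c <= i) = (c <= j).

Lemma linked_ex a i : exists j, `[< linked a i j >].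
Proof. by exists i; apply/asboolP. Qed.

(** A canonical representative of the interval containing [i], so that linked
integers can be compared by an equality. *)
Definition label (a : set nat) (i : nat) : nat := ex_minn (linked_ex a i).

Lemma labelP a i : linked a i (label a i).
Proof. by rewrite /label; case: ex_minnP => j /asboolP. Qed.

Lemma label_linked a i j : label a i = label a j <-> linked a i j.
Proof.
split=> [eq_l c ac|lij].
  by rewrite (labelP i ac) eq_l -(labelP j ac).
rewrite /label; case: ex_minnP => k /asboolP lik kmin.
case: ex_minnP => l /asboolP ljl lmin; apply/eqP.
rewrite eqn_leq kmin ?lmin //; apply/asboolP => c ac.
  by rewrite -(lik _ ac) (lij _ ac).
by rewrite (lij _ ac) ljl.
Qed.

Lemma label_ge a m : infinite_set a -> exists M, forall i, M <= i -> m <= label a i.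
Proof.
move=> /infinite_natP/(_ m)[c ac mc]; exists c => i ci.
by apply: (leq_trans mc); rewrite -(labelP i ac).
Qed.

(** Up to finitely many points, [A] lies in the union of the intervals of [a]
that meet [B]. *)
Definition tracks (a B A : set nat) : Prop :=
  exists m, forall i, A i -> m <= i -> exists2 b, B b & linked a i b.

Definition eventually_meets (h : nat -> nat) (A : set nat) : Prop :=
  exists m, forall n, m <= n -> exists2 i, A i & n <= i < h n.

(** This is |J| < g, in the form in which it is used. *)
Definition groupwise_meets (J : Type) : Prop :=
  forall G : J -> set (set nat), (forall j, groupwise_dense (G j)) ->
  exists a, forall j, G j a.

Definition tracking (S : set (set nat)) (B : set nat) : set (set nat) :=
  [set a | infinite_set a /\ exists2 A, S A & tracks a B A].

(** A base of a nonprincipal ultrafilter is such a family when u < g; the last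
clause says that no set splits all the [B j]. *)
Definition small_reaping (J : Type) (B : J -> set nat) : Prop :=
  [/\ forall j, infinite_set (B j), groupwise_meets J &
      forall W, exists j, B j `<=` W \/ B j `<=` ~` W].

(** Thinning [a] out merges intervals, which keeps linked integers linked;
removing finitely many points at the start only disturbs finitely many
intervals. *)
Lemma tracking_almost_subset S B a b : tracking S B b ->
  infinite_set a -> finite_set (a `\` b) -> tracking S B a.
Proof.
move=> [infb [A SA [m mP]]] infa fin; split=> //; exists A => //.
have [m' m'P] : exists m', forall c, a c -> m' <= c -> b c.
  apply: contrapT => no; apply: (proj2 (infinite_natP (a `\` b))) fin => m'.
  apply: contrapT => no'; apply: no; exists m' => c ac m'c.
  by apply: contrapT => nbc; apply: no'; exists c.
have /infinite_natP/(_ (maxn m m'))[d bd md] := infb.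
exists d => i Ai di.
have mi : m <= i by apply: leq_trans di; apply: leq_trans md; exact: leq_maxl.
have [j Bj lij] := mP i Ai mi; exists j => // c ac.
have [m'c|cm'] := leqP m' c; first exact/lij/m'P.
have cd : c <= d by apply: leq_trans md; rewrite leq_max (ltnW cm') orbT.
by rewrite (leq_trans cd di) (leq_trans cd) // -(lij d bd).
Qed.

(** Blocks arbitrarily far to the right: if [n] lies in the block with right end
[q], the block containing [q] starts at [q] or later. *)
Lemma interval_block (P : set (set nat)) n : interval_partition P ->
  exists2 I, P I & I !=set0 /\ exists N, forall i, I i -> n <= i <= N.
Proof.
move=> [[covP disP nzP] intP].
have block k : exists2 I, P I & I k by have : setT k by []; rewrite -covP.
have [I1 PI1 I1n] := block n; have [p [q I1E]] := intP _ PI1.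
have [I2 PI2 I2q] := block q; have [r [s I2E]] := intP _ PI2.
exists I2 => //; split; first by exists q.
move: I1n; rewrite I1E /= => /andP[pn nq].
exists s => i I2i; move: (I2i); rewrite I2E /= => /andP[ri /ltnW ->].
rewrite andbT leqNgt; apply/negP => i_n.
(* if I2 started before q, the point q - 1 would be in both blocks *)
have I12 : I1 = I2.
  apply: (disP _ _ PI1 PI2); exists q.-1; split.
    by rewrite I1E /= ltn_predL (leq_ltn_trans _ nq) // andbT -ltnS prednK
      ?(leq_ltn_trans _ nq) // (leq_ltn_trans pn nq).
  move: I2q; rewrite I2E /= => /andP[rq qs].
  rewrite (leq_ltn_trans (leq_pred q) qs) andbT -ltnS prednK.
    by apply: leq_ltn_trans ri _; exact: ltn_trans nq.
  exact: leq_ltn_trans nq.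
by move: I2q; rewrite -I12 I1E /= ltnn andbF.
Qed.

(** The trichotomy argument for u < g. Suppose that the sets tracking [B j] fail
to be groupwise dense for some [j], as witnessed by a partition [P]. Let
[h n] lie past a block of [P] to the right of [n] and past a point of [B j]
after that block. If some [A] in [S] missed infinitely many intervals
[n, h n[, the union of the corresponding blocks would track [B j]: between
two consecutive ones, every point of [A] is linked to the point of [B j]
just after the first. *)
Lemma meets_or_tracks (J : Type) (B : J -> set nat) (S : set (set nat)) :
  small_reaping B ->
  (exists h, forall A, S A -> eventually_meets h A) \/
  (exists2 a, infinite_set a & forall j, exists2 A, S A & tracks a (B j) A).
Proof.
move=> [infB gJ /(_ setT)[j0 _]].
have [dense|] := pselect (forall j, groupwise_dense (tracking S (B j))).
  have [a aP] := gJ _ dense; right; exists a; first by case: (aP j0).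
  by move=> j; case: (aP j).
move=> /existsNP[j ndense]; left; move: (infB j) ndense.
move: (B j) => C /infinite_natP infC ndense.
have [P intP noQ] : exists2 P, interval_partition P &
    forall Q, Q `<=` P -> infinite_set Q -> ~ tracking S C (\bigcup_(I in Q) I).
  apply: contrapT => noP; apply: ndense; split.
  - by move=> a [].
  - by move=> a b; exact: tracking_almost_subset.
  - move=> P intP; apply: contrapT => noQ; apply: noP; exists P => // Q QP infQ tQ.
    by apply: noQ; exists Q.
have step n : exists Ib : set nat * nat, [/\ P Ib.1, Ib.1 !=set0, C Ib.2 &
    forall i, Ib.1 i -> n <= i < Ib.2].
  have [I PI [I0 [N IN]]] := interval_block n intP.
  have [b Cb Nb] := infC N.+1; exists (I, b); split=> //= i /IN/andP[-> iN] /=.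
  exact: leq_ltn_trans iN Nb.
have {step}[F FP] := choice step.
exists (fun n => (F n).2.+1) => A SA; apply: contrapT => notmeet.
have step m : exists n, m <= n /\ forall i, A i -> ~~ (n <= i <= (F n).2).
  apply: contrapT => non; apply: notmeet; exists m => n mn.
  apply: contrapT => noi; apply: non; exists n; split=> // i Ai.
  by apply/negP => ni; apply: noi; exists i.
have {step}[v vP] := choice step.
pose x := fix x k := if k is k'.+1 then v (F (x k')).2.+1 else v 0.
have I0 k : exists c, (F (x k)).1 c by case: (FP (x k)).
have xF k : x k < (F (x k)).2.
  have [c Ic] := I0 k; have [_ _ _ /(_ _ Ic)/andP[xc]] := FP (x k).
  exact: leq_ltn_trans.
have Fx k : (F (x k)).2 < x k.+1 by have [] := vP (F (x k)).2.+1.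
have xS k : x k < x k.+1 by exact: ltn_trans (Fx k).
have gap k i : A i -> ~~ (x k <= i <= (F (x k)).2).
  by move: i; case: k => [|k]; [have [_] := vP 0|have [_] := vP (F (x k)).2.+1].
pose Q := range (fun k => (F (x k)).1).
have QP : Q `<=` P by move=> _ [k _ <-]; have [] := FP (x k).
have infQU : infinite_set (\bigcup_(I in Q) I).
  apply/infinite_natP => m; have [c Ic] := I0 m; exists c.
    by exists (F (x m)).1 => //; exists m.
  have [_ _ _ /(_ _ Ic)/andP[xc _]] := FP (x m); apply: leq_trans xc.
  by elim: m {Ic} => // k IH; exact: leq_ltn_trans IH (xS k).
apply: (noQ Q QP).
  move=> finQ; apply: infQU; apply: bigcup_finite => // I /QP PI.
  have [p [q ->]] := intP.2 _ PI.
  by apply: (@sub_finite_set _ _ `I_q) => [k /andP[]//|]; exact: finite_II.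
split=> //; exists A => //; exists (x 0) => i Ai x0i.
have [k /andP[ki ik]] := incr_locate xS x0i.
have Fi : (F (x k)).2 <= i.
  by move: (gap k i Ai); rewrite ki /= -ltnNge => /ltnW.
exists (F (x k)).2; first by case: (FP (x k)).
move=> c [_ [l _ <-] Ilc].
have [_ _ _ /(_ _ Ilc)/andP[lc cl]] := FP (x l).
have [lk|kl] := leqP l k.
  suff cF : c <= (F (x k)).2 by rewrite cF (leq_trans cF Fi).
  move: lk; rewrite leq_eqVlt => /predU1P[<-|lk]; first exact: ltnW.
  apply: leq_trans (ltnW (xF k)); apply: leq_trans (incr_le xS lk).
  by apply: ltnW; exact: ltn_trans cl (Fx l).
have ic : i < c by apply: leq_trans lc; apply: leq_trans ik _; exact: (incr_le xS).
by rewrite (leqNgt c i) ic (leqNgt c _) (leq_ltn_trans Fi ic).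
Qed.

(** * Selection from countable covers *)

(** Asking for infinitely many catches instead of one costs nothing, as a
sequence of covers can be split into infinitely many sequences, and the sets
of catching indices become infinite. *)
Definition selects (X : Type) (O : set (set X)) (Y : set X) : Prop :=
  forall U : nat -> nat -> set X, (forall n m, O (U n m)) ->
  (forall n, Y `<=` \bigcup_m U n m) ->
  exists f : nat -> nat, forall y, Y y -> forall m, exists2 n, m <= n & U n (f n) y.

Definition set_lattice (X : Type) (O : set (set X)) : Prop :=
  [/\ O set0, O setT & setI_closed O].

(** The form of selection used in constructions: covers indexed by a countable
type [T], with the choice at stage [n] restricted to the [t] with [P n t]
also at the stages where nothing is caught. *)
Lemma selects_within (X : Type) (O : set (set X)) (Y : set X) (T : countType)
    (V : nat -> T -> set X) (P : nat -> T -> Prop) :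
  O set0 -> selects O Y -> (forall n t, O (V n t)) ->
  (forall n, exists t, P n t) ->
  (forall n y, Y y -> exists2 t, P n t & V n t y) ->
  exists2 f : nat -> T, forall n, P n (f n) &
    forall y, Y y -> forall m, exists2 n, m <= n & V n (f n) y.
Proof.
move=> O0 selY OV Pex covV; have [d dP] := choice Pex.
pose t n m := if unpickle m is Some t then if `[< P n t >] then t else d n else d n.
pose U n m :=
  if unpickle m is Some t then if `[< P n t >] then V n t else set0 else set0.
have [n m|n y Yy|f fP] := selY U.
- by rewrite /U; case: unpickle => // t'; case: ifP.
- have [t' Pt Vt] := covV n y Yy; exists (pickle t') => //.
  by rewrite /U pickleK asboolT.
exists (fun n => t n (f n)) => [n|y Yy m].
  by rewrite /t; case: unpickle => // t'; case: asboolP.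
have [n mn Un] := fP y Yy m; exists n => //; move: Un; rewrite /U /t.
by case: unpickle => // t'; case: asboolP.
Qed.

Lemma setI_closed_all (X : Type) (O : set (set X)) (A : nat -> set X) (l : seq nat) :
  set_lattice O -> (forall i, O (A i)) -> O [set x | forall i, i \in l -> A i x].
Proof.
move=> [? ? OI] OA; elim: l => [|j l IH].
  by rewrite (_ : [set _ | _] = setT) //; apply/seteqP; split.
rewrite (_ : [set _ | _] = A j `&` [set x | forall i, i \in l -> A i x]).
  exact: OI.
apply/seteqP; split=> x.
  by move=> h; split=> [|i il]; apply: h; rewrite inE ?eqxx ?il ?orbT.
by move=> [] Aj h i; rewrite inE => /predU1P[->|/h].
Qed.

(** Choose from each [e n] two new points, one for [Z] and one for its
complement; the [2 n] points chosen before cannot exhaust [e n]. *)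
Lemma bicolor (e : nat -> seq nat) :
  (forall n, uniq (e n) /\ n.*2.+2 <= size (e n)) ->
  exists Z : set nat, forall n,
    (exists2 c, c \in e n & Z c) /\ (exists2 d, d \in e n & ~ Z d).
Proof.
move=> eP.
pose fresh n (u : seq nat) := [seq c <- e n | c \notin u].
pose u := fix u n := if n is k.+1 then
  [:: nth 0 (fresh k (u k)) 0, nth 0 (fresh k (u k)) 1 & u k] else [::].
have size_u n : size (u n) = n.*2 by elim: n => //= n ->.
have size_fresh n : 1 < size (fresh n (u n)).
  have [uniq_e] := eP n; rewrite -(count_predC [in u n] (e n)) -size_filter => le2.
  have : size [seq c <- e n | c \in u n] <= n.*2.
    rewrite -size_u; apply: uniq_leq_size; first exact: filter_uniq.
    by move=> c; rewrite mem_filter => /andP[].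
  move=> le1; have := leq_trans le2 (leq_add le1 (leqnn _)).
  by rewrite -addn2 leq_add2l /fresh size_filter.
pose p n := nth 0 (fresh n (u n)) 0; pose q n := nth 0 (fresh n (u n)) 1.
have pP n : (p n \notin u n) && (p n \in e n).
  have : p n \in fresh n (u n) by rewrite mem_nth // ltnW.
  by rewrite mem_filter.
have qP n : (q n \notin u n) && (q n \in e n).
  have : q n \in fresh n (u n) by rewrite mem_nth.
  by rewrite mem_filter.
have pq n : p n != q n.
  by rewrite nth_uniq ?filter_uniq ?(ltnW (size_fresh n)) //; case: (eP n).
have u_incl m n : m < n -> (p m \in u n) && (q m \in u n).
  elim: n => // n IH; rewrite ltnS leq_eqVlt => /predU1P[->|/IH/andP[pm qm]].
    by rewrite !inE !eqxx orbT.
  by rewrite !inE pm qm !orbT.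
exists (range p) => n; split.
  by exists (p n); [case/andP: (pP n)|exists n].
exists (q n); first by case/andP: (qP n).
move=> [m _ pmqn]; have [mn|nm|mn] := ltngtP m n.
- by have [/negP] := andP (qP n); rewrite -pmqn; have /andP[->] := u_incl _ _ mn.
- by have [/negP] := andP (pP m); rewrite pmqn; have /andP[_ ->] := u_incl _ _ nm.
- by move: (pq n); rewrite -pmqn mn eqxx.
Qed.

Lemma distinct_labels (a A : set nat) n N : infinite_set a -> infinite_set A ->
  exists l : seq nat, [/\ uniq [seq label a i | i <- l], size l = n,
    forall i, i \in l -> N <= i & forall i, i \in l -> A i].
Proof.
move=> infa /infinite_natP infA; elim: n => [|n [l [uniq_l size_l Nl Al]]].
  by exists [::].
have [M MP] := label_ge (\max_(i <- l) label a i).+1 infa.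
have [i Ai Mi] := infA (maxn M N).
exists (i :: l); split=> [|||j].
- rewrite /= uniq_l andbT; apply/mapP => -[j jl eq_ij].
  have := MP i (leq_trans (leq_maxl _ _) Mi); rewrite eq_ij ltnNge => /negP; apply.
  exact: leq_bigmax_seq.
- by rewrite /= size_l.
- by move=> j; rewrite inE => /predU1P[->|/Nl//]; exact: leq_trans (leq_maxr _ _) Mi.
- by rewrite inE => /predU1P[->|/Al].
Qed.

(** Otherwise the family of the [A y] tracks all [B j] for one [a]. At stage
[n], cover [Y] according to lists of [2 n + 2] elements of [A y] in different
intervals of [a]. The selected lists can be two-colored so that intervals
have a well-defined color and each list has both; every [A y] then has
arbitrarily large points of both colors. But some [B j] has only one color,
and so has the [A y] that [a] makes track it, up to finitely many points. *)
Lemma selects_Hurewicz (J : Type) (B : J -> set nat) (X : Type) (O : set (set X))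
    (Y : set X) (A : X -> set nat) :
  small_reaping B -> set_lattice O -> selects O Y ->
  (forall i, O [set x | A x i]) -> (forall y, Y y -> infinite_set (A y)) ->
  exists h, forall y, Y y -> eventually_meets h (A y).
Proof.
move=> BJ latO selY OA infA; have [_ _ reapB] := BJ.
have [[h hP]|[a infa aP]] := meets_or_tracks [set A y | y in Y] BJ.
  by exists h => y Yy; apply: hP; exists y.
exfalso.
pose good n (l : seq nat) := [/\ uniq [seq label a i | i <- l], n.*2.+2 <= size l &
  forall i, i \in l -> n <= i].
have goodP n (D : set nat) : infinite_set D ->
    exists2 l, good n l & forall i, i \in l -> D i.
  move=> infD; have [l [ul sl nl Dl]] := distinct_labels n.*2.+2 n infa infD.
  by exists l => //; split; rewrite ?sl.
have [||||l goodl lP] := @selects_within X O Y (seq nat)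
    (fun _ l => [set x | forall i, i \in l -> A x i]) good _ selY.
- by case: latO.
- by move=> _ l; exact: (@setI_closed_all _ _ (fun i => [set x | A x i])).
- by move=> n; have [|l gl _] := goodP n setT; [exact: infinite_nat|exists l].
- by move=> n y Yy; have [l gl Al] := goodP n _ (infA y Yy); exists l.
have [n|Z ZP] := @bicolor (fun n => [seq label a i | i <- l n]).
  by have [ul sl _] := goodl n; rewrite size_map.
have both y m : Y y -> (exists i, [/\ A y i, m <= i & Z (label a i)]) /\
                      (exists i, [/\ A y i, m <= i & ~ Z (label a i)]).
  move=> Yy; have [n mn Al] := lP y Yy m; have [_ _ nl] := goodl n.
  have [[_ /mapP[i il ->] Zi] [_ /mapP[k kl ->] nZk]] := ZP n.
  by split; [exists i|exists k]; split=> //;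
    [exact: Al|apply: leq_trans (nl _ il)|exact: Al|apply: leq_trans (nl _ kl)].
have [j BZ] := reapB [set i | Z (label a i)].
have [_ [y Yy <-] [m tr]] := aP j.
have [[i [Ai mi Zi]] [k [Ak mk nZk]]] := both y m Yy.
case: BZ => BZ.
  by have [b /BZ/= Zb /label_linked lkb] := tr k Ak mk; rewrite lkb in nZk.
by have [b /BZ/= Zb /label_linked lib] := tr i Ai mi; rewrite lib in Zi.
Qed.

(** By Bartoszynski's characterization of cov(M), this is |I| < cov(M); one
direction is [not_cov_guessable]. *)
Definition guessable (I : Type) : Prop :=
  forall f : I -> nat -> nat, exists g : nat -> nat,
  forall i m, exists2 n, m <= n & g n = f i n.

Lemma guessable_count (I : Type) (T : countType) (f : I -> nat -> T) (t0 : T) :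
  guessable I ->
  exists g : nat -> T, forall i m, exists2 n, m <= n & g n = f i n.
Proof.
move=> /(_ (fun i n => pickle (f i n)))[g gP].
exists (fun n => odflt t0 (unpickle (g n))) => i m.
by have [n mn gn] := gP i m; exists n => //; rewrite gn pickleK.
Qed.

Lemma guessable_selects (I X : Type) (O : set (set X)) (F : I -> X) (Y : set X) :
  guessable I -> Y `<=` range F -> selects O Y.
Proof.
move=> gI YF U _ covU.
have pick i : exists f : nat -> nat, Y (F i) -> forall n, U n (f n) (F i).
  have [YFi|nYFi] := pselect (Y (F i)); last by exists id.
  have cov n : exists m, U n m (F i) by have [m _] := covU n _ YFi; exists m.
  by have [f fP] := choice cov; exists f.
have [f fP] := choice pick; have [g gP] := gI f.
exists g => y Yy m; have [i _ Fiy] := YF _ Yy.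
by have [n mn gn] := gP i m; exists n => //; rewrite gn -Fiy; apply: fP; rewrite Fiy.
Qed.

Lemma incr_iter (h : nat -> nat) : exists2 d : nat -> nat,
  forall k, d k < d k.+1 & forall k, h (d k) <= d k.+1.
Proof.
exists (fun k => iter k (fun n => maxn n.+1 (h n)) 0) => k /=.
  exact: leq_maxl.
exact: leq_maxr.
Qed.

Lemma incr_ge (d : nat -> nat) : (forall k, d k < d k.+1) -> forall k, k <= d k.
Proof. by move=> dS; elim=> // k IH; exact: leq_ltn_trans IH (dS k). Qed.

(** An interval of the form [n, H (H n)[ contains two points of the range of [x],
hence two consecutive ones. *)
Lemma orbit_between (x d H : nat -> nat) : (forall k, x k < x k.+1) ->
  eventually_meets H (range x) ->
  (forall k, d k < d k.+1) -> (forall k, H (H (d k)) <= d k.+1) ->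
  exists k0, forall k, k0 <= k -> exists2 r, d k <= x r & x r.+1 < d k.+1.
Proof.
move=> xS [m mP] dS dH; exists m => k mk.
have md : m <= d k by apply: leq_trans mk (incr_ge dS k).
have [_ [r _ <-] /andP[dr rH]] := mP (d k) md.
have mH : m <= H (d k) by apply: (leq_trans md); exact: leq_trans dr (ltnW rH).
have [_ [s _ <-] /andP[Hs sH]] := mP (H (d k)) mH.
have rs : r < s.
  rewrite ltnNge; apply/negP => /(incr_le xS) sr.
  by have := leq_ltn_trans (leq_trans Hs sr) rH; rewrite ltnn.
exists r => //; apply: leq_ltn_trans (incr_le xS rs) _.
exact: leq_trans sH (dH k).
Qed.

(** The sets [A i y] of catching indices have gaps bounded by [h i], so they meet
almost every interval between consecutive points of an orbit [x i] of [h i].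
The intervals between consecutive [d k] contain such intervals for every [i],
and a guess of the restriction of [f i] to one of them catches [y] there. *)
Lemma selects_bigcup (J : Type) (B : J -> set nat) (I X : Type) (O : set (set X))
    (F : I -> set X) :
  small_reaping B -> set_lattice O -> guessable I -> (forall i, selects O (F i)) ->
  selects O (\bigcup_i F i).
Proof.
move=> BJ latO gI selF U OU covU.
have one i : exists f : nat -> nat, forall y, F i y ->
    forall m, exists2 n, m <= n & U n (f n) y.
  by apply: selF => // n y Fy; apply: covU; exists i.
have {one}[f fP] := choice one.
pose A i y := [set n | U n (f i n) y].
have one i : exists h, forall y, F i y -> eventually_meets h (A i y).
  apply: (@selects_Hurewicz J B X O) => // [n|y Fy]; first exact: OU.
  by apply/infinite_natP => m; have [n mn Un] := fP i y Fy m; exists n.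
have {one}[h hP] := choice one.
have one i : exists x : nat -> nat, (forall k, x k < x k.+1) /\
    (forall k, h i (x k) <= x k.+1).
  by have [x] := incr_iter (h i); exists x.
have {one}[x xP] := choice one.
(* a set of guessable size selects, so the orbits of the h i have bounded gaps *)
have [||||H HP] := @selects_Hurewicz J B I setT setT (fun i => range (x i)) BJ.
- by split.
- by apply: (@guessable_selects I I setT id) => // i _; exists i.
- by [].
- move=> i _; apply/infinite_natP => m; exists (x i m); first by exists m.
  by apply: incr_ge; case: (xP i).
have [d dS dH] := incr_iter (fun n => H (H n)).
have meets i y : F i y -> exists k0, forall k, k0 <= k ->
    exists2 n, A i y n & d k <= n < d k.+1.
  move=> Fy; have [m1 m1P] := hP i y Fy.
  have [xS xh] := xP i.
  have [k0 k0P] := orbit_between xS (HP i Logic.I) dS dH.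
  exists (maxn m1 k0) => k; rewrite geq_max => /andP[m1k k0k].
  have [r dr rd] := k0P k k0k.
  have [n An /andP[xn nh]] := m1P (x i r) (leq_trans m1k (leq_trans (incr_ge dS k) dr)).
  exists n => //; rewrite (leq_trans dr xn) /=.
  exact: leq_trans nh (leq_trans (xh r) (ltnW rd)).
have [g gP] := guessable_count (fun i k => [seq f i n | n <- iota 0 (d k.+1)]) [::] gI.
have block n : exists k, d k <= n < d k.+1 \/ n < d 0.
  have [d0n|nd0] := leqP (d 0) n; last by exists 0; right.
  by have [k kP] := incr_locate dS d0n; exists k; left.
have {block}[kk kkP] := choice block.
exists (fun n => nth 0 (g (kk n)) n) => y [i _ Fy] m.
have [k0 k0P] := meets i y Fy; have [k k0k gk] := gP i (maxn k0 m).
move: k0k; rewrite geq_max => /andP[k0k mk].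
have [n An /andP[dn nd]] := k0P k k0k.
exists n; first by apply: leq_trans mk _; apply: leq_trans (incr_ge dS k) dn.
suff -> : kk n = k by rewrite gk (nth_map 0) ?size_iota // nth_iota.
have dm := incr_le dS.
have [/andP[l1 l2]|nd0] := kkP n; last first.
  by have := leq_trans nd0 (leq_trans (dm _ _ (leq0n k)) dn); rewrite ltnn.
apply/eqP; rewrite eqn_leq; apply/andP; split; rewrite leqNgt; apply/negP => lt.
  by have := leq_trans nd (leq_trans (dm _ _ lt) l1); rewrite ltnn.
by have := leq_trans l2 (leq_trans (dm _ _ lt) dn); rewrite ltnn.
Qed.

(** * Guessing from the covering number of the meager ideal *)

Local Open Scope ring_scope.

(** Being nowhere dense, in terms of closed intervals and without closures. *)
Definition shrinks (R : realType) (C : set R) : Prop :=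
  forall a b, a < b -> exists a' b', [/\ a' < b', a <= a', b' <= b &
    forall z, a' <= z <= b' -> ~ C z].

Lemma shrinks_nowhere_dense (R : realType) (C : set R) :
  shrinks C -> nowhere_dense C.
Proof.
move=> shC; apply/seteqP; split=> // x.
rewrite /interior => /nbhs_ballP[e /= e0 xe].
have [a [b [ab xa bx noC]]] := shC (x - e / 2) (x + e / 2) ltac:(lra).
have mid : closure C ((a + b) / 2).
  by apply: xe; rewrite ball_itv /= in_itv /=; apply/andP; split; lra.
have [|z [Cz]] := mid (ball ((a + b) / 2) ((b - a) / 2)).
  by apply: nbhsx_ballx; lra.
rewrite ball_itv /= in_itv /= => /andP[z1 z2].
by apply: (noC z) => //; apply/andP; split; lra.
Qed.

Lemma nowhere_dense_shrinks (R : realType) (C : set R) :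
  nowhere_dense C -> shrinks C.
Proof.
move=> ndC a b ab.
have [x [/andP[ax xb] nCx]] : exists x, a < x < b /\ ~ closure C x.
  apply: contrapT => nox; have : set0 ((a + b) / 2) :> Prop; last by [].
  rewrite -ndC /interior; apply/nbhs_ballP; exists ((b - a) / 2) => /=; first lra.
  move=> z; rewrite ball_itv /= in_itv /= => /andP[z1 z2].
  apply: contrapT => nCz; apply: nox; exists z; split=> //.
  by apply/andP; split; lra.
have : nbhs x (~` C).
  by apply: contrapT => nCC; apply: nCx => V Vx; apply: contrapT => /set0P/negP;
    rewrite negbK => /eqP VC; apply: nCC; apply: filterS Vx => z Vz Cz;
    have : (C `&` V) z by []; rewrite VC.
move=> /nbhs_ballP[e /= e0 xe].
pose r := Num.min (e / 2) (Num.min (x - a) (b - x)).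
have r0 : 0 < r by rewrite !lt_min; apply/andP; split; [lra|apply/andP; split; lra].
have re : r <= e / 2 by rewrite ge_min lexx.
have rx : r <= x - a by rewrite !ge_min lexx orbT.
have rb : r <= b - x by rewrite !ge_min lexx !orbT.
exists (x - r), (x + r); split; [lra|lra|lra|].
move=> z /andP[z1 z2]; apply: xe; rewrite ball_itv /= in_itv /=.
by apply/andP; split; lra.
Qed.

Lemma shrinks_bigcup (R : realType) (C : nat -> set R) n :
  (forall k, shrinks (C k)) -> shrinks (\bigcup_(k in `I_n) C k).
Proof.
move=> shC; elim: n => [|n IH] a b ab.
  by exists a, b; split=> // z _ [].
have [a1 [b1 [ab1 aa1 bb1 no1]]] := IH a b ab.
have [a2 [b2 [ab2 aa2 bb2 no2]]] := shC n a1 b1 ab1.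
exists a2, b2; split=> //; [exact: le_trans aa2|exact: le_trans bb1|].
move=> z /andP[z1 z2] [k /=]; rewrite ltnS leq_eqVlt => /predU1P[-> Cz|kn Cz].
  by apply: (no2 z) => //; apply/andP.
apply: (no1 z); last by exists k.
by rewrite (le_trans aa2) // (le_trans z2).
Qed.

(** A sequence of functions of [r] that take every value on every interval from
some [n] on: the inverse of the fractional part of a large multiple of [r]
runs through all large reals. It exceeds 1, whence the predecessor. *)
Definition digit (R : realType) (r : R) (n : nat) : nat :=
  (Num.truncn (n.+1%:R * r - (Num.floor (n.+1%:R * r))%:~R)^-1).-1.

(** For [n] large, the interval contains a full period of [n.+1%:R * r], and
[digit] takes the value [v] when its fractional part lies between
[(v + 2)^-1] and [(v + 1)^-1]. *)
Lemma digit_interval (R : realType) (a b : R) (m : nat) : a < b ->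
  exists2 n, (m <= n)%N & forall v, exists a' b',
    [/\ a' < b', a <= a', b' <= b & forall z, a' <= z <= b' -> digit z n = v].
Proof.
move=> ab; pose N := Num.Def.archi_bound (2 / (b - a)).
have bN : 2 / (b - a) < N%:R.
  by apply: archi_boundP; rewrite divr_ge0 ?ler0n //; lra.
exists (maxn m N) => [|v]; first exact: leq_maxl.
set n := maxn m N; pose s : R := n.+1%:R.
have s0 : 0 < s by rewrite ltr0n.
have sab : 2 < s * (b - a).
  have : 2 / (b - a) < s.
    by apply: (lt_trans bN); rewrite ltr_nat ltnS leq_maxr.
  by rewrite ltr_pdivrMr //; lra.
have /andP[k1 k2] := floor_itv (s * a).
move: (Num.floor (s * a)) k1 k2 => k0 k1 k2.
set k := k0 + 1 in k2.
have kE : k%:~R = k0%:~R + 1 :> R by rewrite intrD.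
(* on this interval the fractional part of s * z lies strictly between
   1 / (v + 2) and 1 / (v + 1) *)
pose u : R := v%:R.
have u0 : 0 <= u by rewrite ler0n.
pose t1 := (u + 1 + 2 / 3)^-1; pose t2 := (u + 1 + 1 / 3)^-1.
have t12 : t1 < t2 by rewrite ltf_pV2 ?posrE; lra.
have t10 : 0 < t1 by rewrite invr_gt0; lra.
have t21 : t2 < 1 by rewrite invf_lt1; lra.
exists ((k%:~R + t1) / s), ((k%:~R + t2) / s); split.
- by rewrite ltr_pM2r ?invr_gt0 //; lra.
- by rewrite ler_pdivlMr // mulrC; lra.
- by rewrite ler_pdivrMr //; lra.
move=> z; rewrite ler_pdivrMr // ler_pdivlMr // => /andP[z1 z2].
rewrite /digit -/s; have -> : Num.floor (s * z) = k.
  by apply: floor_def; rewrite intrD; apply/andP; split; lra.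
set f := s * z - k%:~R.
have f1 : t1 <= f by rewrite /f; lra.
have f2 : f <= t2 by rewrite /f; lra.
have f0 : 0 < f by exact: lt_le_trans f1.
have -> : Num.truncn f^-1 = v.+1.
  apply: truncn_def; rewrite -[v.+2%:R]natr1 -[v.+1%:R]natr1 -/u.
  have : t2^-1 <= f^-1 by rewrite lef_pV2 ?posrE //; lra.
  have : f^-1 <= t1^-1 by rewrite lef_pV2 ?posrE.
  by rewrite /t1 /t2 !invrK => ? ?; apply/andP; split; lra.
by [].
Qed.

(** If no [g] guesses [f], the sets of those reals whose digits are eventually
different from [f i] cover the line, and they are meager. *)
Lemma not_cov_guessable (R : realType) (K I : Type) :
  cov_meager R K -> ~ ([set: K] #<= [set: I])%card -> guessable I.
Proof.
move=> [_ minK] KI f; apply: contrapT => nog; apply: KI.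
pose M i := \bigcup_m [set r : R | forall n, (m <= n)%N -> digit r n <> f i n].
have /minK KM : exists2 F : set (set R),
    (F `<=` @meager R /\ \bigcup_(A in F) A = setT) & ([set: range M] #= F)%card.
  exists (range M); last exact: card_setT.
  split=> [_ [i _ <-]|].
    exists (fun m => [set r : R | forall n, (m <= n)%N -> digit r n <> f i n]) => // m.
    apply: shrinks_nowhere_dense => a b ab.
    have [n mn nP] := digit_interval m ab.
    have [a' [b' [ab' aa' bb' dig]]] := nP (f i n).
    by exists a', b'; split=> // z /dig dz /(_ n mn).
  apply/seteqP; split=> // r _; apply: contrapT => nr; apply: nog.
  exists (digit r) => i m.
  apply: contrapT => non; apply: nr; exists (M i); first by exists i.
  by exists m => // n mn /= eq_n; apply: non; exists n.
apply: card_le_trans KM _; rewrite (card_le_eql (card_setT _)).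
exact: card_image_le.
Qed.

(** * A set of codes of meager sets that does not select *)

(** An enumeration of the nondegenerate rational intervals, the default being
the unit interval. *)
Definition rat_itv (j : nat) : rat * rat :=
  let pq := odflt (0, 1) (unpickle j : option (rat * rat)) in
  if pq.1 < pq.2 then pq else (0, 1).

Lemma rat_itv_lt j : (rat_itv j).1 < (rat_itv j).2.
Proof. by rewrite /rat_itv; case: ifP. Qed.

Lemma rat_itv_pickle (p q : rat) : p < q -> rat_itv (pickle (p, q)) = (p, q).
Proof. by move=> pq; rewrite /rat_itv pickleK /= pq. Qed.

Definition itv_lo (R : realType) (j : nat) : R := ratr (rat_itv j).1.
Definition itv_hi (R : realType) (j : nat) : R := ratr (rat_itv j).2.

Definition escapes (R : realType) (C : set R) (i j : nat) : Prop :=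
  [/\ itv_lo R i <= itv_lo R j, itv_hi R j <= itv_hi R i &
      forall z, itv_lo R j <= z <= itv_hi R j -> ~ C z].

Lemma shrinks_escapes (R : realType) (C : set R) i :
  shrinks C -> exists j, escapes C i j.
Proof.
move=> shC; have lohi : itv_lo R i < itv_hi R i by rewrite ltr_rat rat_itv_lt.
have [a [b [ab la bh noC]]] := shC _ _ lohi.
have [p] := rat_in_itvoo ab; rewrite in_itv /= => /andP[ap pb].
have [q] := rat_in_itvoo pb; rewrite in_itv /= => /andP[pq qb].
have pq' : p < q by rewrite -(ltr_rat R).
exists (pickle (p, q)); rewrite /escapes /itv_lo /itv_hi rat_itv_pickle //=.
split; [exact: le_trans la (ltW ap)|exact: le_trans (ltW qb) bh|].
move=> z /andP[pz zq]; apply: noC.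
by rewrite (le_trans (ltW ap) pz) (le_trans zq (ltW qb)).
Qed.

Lemma nested_point (R : realType) (j : nat -> nat) :
  (forall k, itv_lo R (j k) <= itv_lo R (j k.+1)) ->
  (forall k, itv_hi R (j k.+1) <= itv_hi R (j k)) ->
  exists z, forall k, itv_lo R (j k) <= z <= itv_hi R (j k).
Proof.
move=> lo hi.
have lo_le k l : (k <= l)%N -> itv_lo R (j k) <= itv_lo R (j l).
  by elim: l => [|l IH]; rewrite leq_eqVlt => /predU1P[->|] // /IH/le_trans; apply.
have hi_le k l : (k <= l)%N -> itv_hi R (j l) <= itv_hi R (j k).
  by elim: l => [|l IH]; rewrite leq_eqVlt => /predU1P[->|] // /IH; apply: le_trans.
have lohi k l : itv_lo R (j k) <= itv_hi R (j l).
  apply: (le_trans (lo_le _ _ (leq_maxl k l))).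
  apply: le_trans (hi_le _ _ (leq_maxr k l)).
  by rewrite ler_rat ltW ?rat_itv_lt.
pose E := range (fun k => itv_lo R (j k)).
exists (sup E) => k; apply/andP; split.
  apply: ub_le_sup; last by exists k.
  by exists (itv_hi R (j 0)) => _ [l _ <-].
by apply: ge_sup => [|_ [l _ <-]//]; exists (itv_lo R (j 0)); exists 0.
Qed.

(** A code carries at each [n] a list of integers and one bit; the bits make up a
set of integers that depends on the code in an open way. *)
Definition marked_part (z : nat -> nat) : set nat :=
  [set n | exists l : seq nat, unpickle (z n) = Some (true, l)].

(** The list at [n] tells how to escape, from each of the intervals [0] to [n],
the first [n.+1] nowhere dense sets. The marked set records the growth of
these lists: the next marked integer bounds all the answers up to the current
one. Bounding the gaps of the marked sets therefore bounds the codes. *)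
Lemma meager_code (R : realType) (M : set R) : meager M ->
  exists (C : nat -> set R) (psi : nat -> nat -> nat) (z : nat -> nat),
  [/\ M = \bigcup_n C n, forall n i, escapes (\bigcup_(k in `I_n.+1) C k) i (psi n i),
      exists2 x : nat -> nat, (forall k, (x k < x k.+1)%N) /\
         (forall k i n, (i <= x k)%N -> (n <= x k)%N -> (psi n i < x k.+1)%N) &
         marked_part z = range x &
      forall n, exists b : bool,
        unpickle (z n) = Some (b, [seq psi n i | i <- iota 0 n.+1])].
Proof.
move=> [C ndC ->]; exists C.
have ex n : exists f : nat -> nat, forall i, escapes (\bigcup_(k in `I_n.+1) C k) i (f i).
  have ex i : exists j, escapes (\bigcup_(k in `I_n.+1) C k) i j.
    by apply: shrinks_escapes; apply: shrinks_bigcup => k; exact: nowhere_dense_shrinks.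
  by have [f fP] := choice ex; exists f.
have {ex}[psi psiP] := choice ex; exists psi.
pose h N := (\max_(n < N.+1) \max_(i < N.+1) (psi n i)).+1.
have [x xS xh] := incr_iter h.
exists (fun n => pickle (`[< range x n >], [seq psi n i | i <- iota 0 n.+1])).
split=> //.
- exists x; first split=> // k i n ik nk.
    apply: leq_trans (xh k); rewrite ltnS.
    rewrite -ltnS in ik; rewrite -ltnS in nk.
    apply: leq_trans (leq_bigmax (Ordinal nk)).
    exact: (leq_bigmax (Ordinal ik) : psi n (Ordinal ik) <= _)%N.
  apply/seteqP; split=> [n [l]|n xn]; first by rewrite pickleK => -[/asboolP].
  by exists [seq psi n i | i <- iota 0 n.+1]; rewrite pickleK asboolT.
- by move=> n; exists `[< range x n >]; rewrite pickleK.
Qed.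

(** Suppose that the codes select. By [selects_Hurewicz] there are integers
[d k] such that, for each code and all large [k], the list at [d k] answers
questions up to [d k] by indices below [d k.+1]. Selecting the lists at
[d k], one gets a sequence [s]; following its answers when they make sense
gives nested intervals. Their common point lies in some [M] of the cover, but
for infinitely many [k] the list [s k] is the one in the code of [M], and
the interval then escapes the first [d k] pieces of [M]. *)
Lemma meager_cover_not_selects (R : realType) (J : Type) (B : J -> set nat)
    (F : set (set R)) (O : set (set (nat -> nat))) :
  small_reaping B -> set_lattice O -> (forall n (V : set nat), O [set z | V (z n)]) ->
  F `<=` @meager R -> \bigcup_(M in F) M = setT ->
  exists p : set R -> nat -> nat, ~ selects O (p @` F).
Proof.
move=> BJ latO cylO Fm Fcov.
have ex (M : set R) : exists t : (nat -> set R) * (nat -> nat -> nat) * (nat -> nat),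
    F M -> [/\ M = \bigcup_n t.1.1 n,
      forall n i, escapes (\bigcup_(k in `I_n.+1) t.1.1 k) i (t.1.2 n i),
      exists2 x : nat -> nat, (forall k, (x k < x k.+1)%N) /\
         (forall k i n, (i <= x k)%N -> (n <= x k)%N -> (t.1.2 n i < x k.+1)%N) &
         marked_part t.2 = range x &
      forall n, exists b : bool,
        unpickle (t.2 n) = Some (b, [seq t.1.2 n i | i <- iota 0 n.+1])].
  have [FM|nFM] := pselect (F M); last by exists (fun=> set0, fun _ _ => 0%N, id).
  have [C [psi [z P]]] := meager_code (Fm _ FM).
  by exists (C, psi, z).
have {ex}[t tP] := choice ex.
exists (fun M => (t M).2) => selD.
have [||h hP] := selects_Hurewicz BJ latO selD (A := marked_part).
- by move=> n; apply: (cylO n [set v | exists l : seq nat, unpickle v = Some (true, l)]).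
- move=> _ [M FM <-]; have [_ _ [x [xS _] ->] _] := tP M FM.
  apply/infinite_natP => m; exists (x m); first by exists m.
  exact: incr_ge.
have [d dS dh] := incr_iter (fun n => h (h n)).
have [||||s _ sP] := @selects_within _ O _ (seq nat)
  (fun k l => [set z | exists b : bool, unpickle (z (d k)) = Some (b, l)])
  (fun _ _ => True) _ selD.
- by case: latO.
- by move=> k l; apply: (cylO (d k) [set v | exists b : bool, unpickle v = Some (b, l)]).
- by move=> _; exists [::].
- move=> k _ [M FM <-]; have [_ _ _ /(_ (d k))[b zE]] := tP M FM.
  by exists [seq (t M).1.2 (d k) i | i <- iota 0 (d k).+1] => //; exists b.
pose ok k i j := [&& (j < d k.+1)%N, itv_lo R i <= itv_lo R j & itv_hi R j <= itv_hi R i].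
pose j := fix j k := if k is k'.+1 then
  let c := nth 0%N (s k') (j k') in if ok k' (j k') c then c else j k' else 0%N.
have jS k : j k.+1 = let c := nth 0%N (s k) (j k) in if ok k (j k) c then c else j k by [].
have jd k : (j k <= d k)%N.
  elim: k => // k IH; rewrite jS /=; case: ifP => [/and3P[/ltnW]//|_].
  exact: leq_trans IH (ltnW (dS k)).
have [k|k|z zP] := @nested_point R j.
- by rewrite jS /=; case: ifP => // /and3P[].
- by rewrite jS /=; case: ifP => // /and3P[].
have [M FM Mz] : exists2 M, F M & M z.
  by have : setT z by []; rewrite -Fcov => -[M]; exists M.
have [ME esc [x [xS xpsi] xE] _] := tP M FM.
have zD : [set (t M').2 | M' in F] (t M).2 by exists M.
have := hP _ zD; rewrite xE => /(orbit_between xS)/(_ dS dh)[k0 k0P].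
move: (Mz); rewrite ME => -[n0 _ Cz].
have [k mk [b zE]] := sP _ zD (maxn k0 n0).
move: mk; rewrite geq_max => /andP[k0k n0k].
have sE : s k = [seq (t M).1.2 (d k) i | i <- iota 0 (d k).+1].
  by have [_ _ _ /(_ (d k))[b']] := tP M FM; rewrite zE => -[_ ->].
have [r dr rd] := k0P k k0k.
have jE : nth 0%N (s k) (j k) = (t M).1.2 (d k) (j k).
  by rewrite sE (nth_map 0%N) ?size_iota ?ltnS // nth_iota ?ltnS.
have [lo hi noC] := esc (d k) (j k).
have jk1 : j k.+1 = (t M).1.2 (d k) (j k).
  rewrite jS /= jE /ok lo hi !andbT; case: ifP => // /negP[].
  apply: leq_ltn_trans rd; apply: ltnW; apply: xpsi => //.
  exact: leq_trans (jd k) dr.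
apply: (noC z); first by rewrite -jk1.
exists n0 => //=; rewrite ltnS; apply: (leq_trans n0k); exact: incr_ge.
Qed.

(** * Selection principles in topological spaces *)

Local Close Scope ring_scope.
Local Open Scope card_scope.

Lemma open_lattice (X : topologicalType) : set_lattice (@open X).
Proof. by split; [exact: open0|exact: openT|move=> A B; exact: openI]. Qed.

Lemma borelC (X : topologicalType) (A : set X) :
  <<s @open X >> A -> <<s @open X >> (~` A).
Proof. by move=> bA; rewrite -setTD; exact: sigma_algebraCD. Qed.

Lemma borel_lattice (X : topologicalType) : set_lattice <<s @open X >>.
Proof.
split; first exact: sigma_algebra0.
  by apply: sub_sigma_algebra; exact: openT.
move=> A B bA bB; rewrite -[A `&` B]setCK setCI; apply: borelC.
rewrite -bigcup2E; apply: sigma_algebra_bigcup => -[|[|n]] /=.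
- exact: borelC.
- exact: borelC.
- exact: sigma_algebra0.
Qed.

Lemma borel_preimage (X T : topologicalType) (v : T -> X) (A : set X) :
  continuous v -> <<s @open X >> A -> <<s @open T >> (v @^-1` A).
Proof.
move=> /continuousP cv bA.
suff : image_set_system setT v <<s @open T >> A by rewrite /image_set_system /= setTI.
apply: (smallest_sub _ _ bA).
  by apply: sigma_algebra_image; exact: smallest_sigma_algebra.
move=> B oB; rewrite /image_set_system /= setTI.
by apply: sub_sigma_algebra; exact: cv.
Qed.

(** A cover must not contain the whole space. If the trace on [T] of some set of
the given families is everything, choosing that set already catches all
points; otherwise the traces are covers to which S_1 applies. Applying this
to infinitely many subsequences catches points infinitely often. *)
Lemma S1_selects (X T : topologicalType)
    (A : forall Z : topologicalType, set (set (set Z))) (OX : set (set X))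
    (OT : set (set T)) (v : T -> X) :
  (forall U, OX U -> OT (v @^-1` U)) ->
  (forall g : nat -> set T, (forall m, OT (g m)) -> is_cover (range g) -> A T (range g)) ->
  (forall U, A T U -> is_cover U) ->
  S1 A A T -> selects OX (range v).
Proof.
move=> OXT mkA Acov S1T U OU covU.
have covT n t : exists m, U n m (v t) by have [m _] := covU n (v t) (imageT v t); exists m.
have once (e : nat -> nat) : exists f : nat -> nat, forall t, exists q, U (e q) (f q) (v t).
  have [[q [m UT]]|noT] := pselect (exists q m, v @^-1` U (e q) m = setT).
    exists (fun=> m) => t; exists q.
    by have : setT t by []; rewrite -UT.
  have [q|V UV VA] := S1T (fun q => range (fun m => v @^-1` U (e q) m)).
    apply: mkA => [m|]; first exact/OXT/OU.
    split; last by move=> [m _ UT]; apply: noT; exists q, m.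
    apply/seteqP; split=> // t _; have [m Um] := covT (e q) t.
    by exists (v @^-1` U (e q) m) => //; exists m.
  have pick q : exists m, V q = v @^-1` U (e q) m by have [m _ <-] := UV q; exists m.
  have [f fP] := choice pick; exists f => t.
  have : setT t by []; rewrite -(Acov _ VA).1 => -[_ [q _ <-] Vt].
  by exists q; move: Vt; rewrite fP.
have pick (p : nat) : exists f : nat -> nat,
    forall t, exists q, U (pickle (p, q)) (f q) (v t).
  exact: once (fun q => pickle (p, q)).
have [f fP] := choice pick.
exists (fun n => if unpickle n is Some pq then f pq.1 pq.2 else 0) => _ [t _ <-] m.
have [q qP] := choice (fun p => fP p t).
have inj : injective (fun p => pickle (p, q p)).
  by move=> p p' /(pcan_inj pickleK)[].
have [p mp] := injective_gtn inj m.
by exists (pickle (p, q p)); [exact: ltnW|rewrite pickleK].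
Qed.

Lemma selects_S1 (X : topologicalType)
    (A : forall Z : topologicalType, set (set (set Z))) (O : set (set X)) :
  (forall U, A X U -> [/\ is_cover U, U `<=` O & exists2 g : nat -> set X,
     (forall m, U (g m)) & \bigcup_m g m = setT]) ->
  (forall V : nat -> set X, (forall n, O (V n)) -> is_cover (range V) -> A X (range V)) ->
  selects O setT -> S1 A A X.
Proof.
move=> unA mkA selX U AU.
have pick n : exists g : nat -> set X, (forall m, U n (g m)) /\ \bigcup_m g m = setT.
  by have [_ _ [g]] := unA _ (AU n); exists g.
have [g gP] := choice pick.
have UO n : U n `<=` O by have [] := unA _ (AU n).
have [n m|n x _|f fP] := selX g.
- by apply: (UO n); exact: (gP n).1.
- by rewrite (gP n).2.
exists (fun n => g n (f n)) => [n|]; first exact: (gP n).1.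
apply: mkA => [n|]; first by apply: (UO n); exact: (gP n).1.
split.
  apply/seteqP; split=> // x _; have [n _ gx] := fP x Logic.I 0.
  by exists (g n (f n)) => //; exists n.
move=> [n _ gT]; have [[_ noT] _ _] := unA _ (AU n); apply: noT.
by rewrite -gT; exact: (gP n).1.
Qed.

Lemma countable_cover_range (X : Type) (U : set (set X)) :
  [set: X] !=set0 -> countable U -> \bigcup_(A in U) A = setT ->
  exists2 g : nat -> set X, (forall m, U (g m)) & \bigcup_m g m = setT.
Proof.
move=> [x _] cU covU.
have [A0 UA0] : exists A, U A.
  by have : setT x by []; rewrite -covU => -[A UA _]; exists A.
move: cU => /pcard_leP/unsquash f.
pose g n := xget A0 [set A | U A /\ f A = n].
have gU m : U (g m).
  by rewrite /g; case: xgetP => [A _ []|].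
exists g => //; apply/seteqP; split=> // y _.
have : setT y by []; rewrite -covU => -[A UA Ay]; exists (f A) => //.
rewrite /g; case: xgetP => [B _ [UB fB]|/(_ A)[]//].
by rewrite (_ : B = A) //; apply: (@inj _ _ U f); rewrite ?inE.
Qed.

Lemma range_val (X : Type) (A : set X) : range (val : set_type A -> X) = A.
Proof.
apply/seteqP; split=> [_ [[x Ax] _ <-]|x Ax]; first exact: set_mem.
by exists (SigSub (mem_set Ax)).
Qed.

Lemma val_continuous (X : topologicalType) (A : set X) :
  continuous (val : set_type A -> X).
Proof. exact: initial_continuous. Qed.

Lemma open_S1_selects (X : topologicalType) (A : set X) :
  S1 open_covers open_covers (set_type A) -> selects open A.
Proof.
rewrite -[in selects _ _](range_val A).
apply: (@S1_selects X (set_type A) open_covers open open val) => //.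
- by have /continuousP := @val_continuous X A.
- by move=> g og covg; split=> // _ [m _ <-].
- by move=> U [].
Qed.

Lemma borel_S1_selects (X : topologicalType) (A : set X) :
  S1 borel_covers borel_covers (set_type A) -> selects <<s @open X >> A.
Proof.
rewrite -[in selects _ _](range_val A).
apply: (@S1_selects X (set_type A) borel_covers <<s @open X >>
  <<s @open (set_type A) >> val) => //.
- by move=> U; apply: borel_preimage; exact: val_continuous.
- move=> g bg covg; split=> //; last by move=> _ [m _ <-].
  exact: card_le_trans (card_image_le _ _) (countableP _).
- by move=> U [].
Qed.

Lemma open_selects_S1 (X : topologicalType) : [set: X] !=set0 ->
  lindelof_space X -> selects (@open X) setT -> S1 open_covers open_covers X.
Proof.
move=> X0 lindX; apply: selects_S1 => [U [covU oU]|V oV covV].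
  split=> //; have [V [VU cV covV]] := lindX U oU covU.1.
  have [g gV gT] := countable_cover_range X0 cV covV.
  by exists g => // m; apply: VU.
by split=> // _ [n _ <-].
Qed.

Lemma borel_selects_S1 (X : topologicalType) : [set: X] !=set0 ->
  selects <<s @open X >> setT -> S1 borel_covers borel_covers X.
Proof.
move=> X0; apply: selects_S1 => [U [covU cU bU]|V bV covV].
  by split=> //; exact: countable_cover_range X0 cU covU.1.
split=> //; last by move=> _ [n _ <-].
exact: card_le_trans (card_image_le _ _) (countableP _).
Qed.

(** Vacuously: a one-point space has no cover in this sense. *)
Lemma S1_singleton (A : forall Z : topologicalType, set (set (set Z)))
    (X : topologicalType) (x : X) :
  (forall U, A X U -> is_cover U) -> [set: X] = [set x] -> S1 A A X.
Proof.
move=> Acov Xx U /(_ 0)/Acov[covU noT]; apply: contrapT => _; apply: noT.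
have [V UV Vx] : (\bigcup_(V in U 0) V) x by rewrite covU.
suff -> : [set: X] = V by [].
by apply/seteqP; split=> // y; rewrite Xx => ->.
Qed.

Notation baire := {ptws nat -> nat}.

(** The filter of the cylinders around [x] converges to [x], since it does so in
each coordinate. *)
Lemma baire_nbhs (x : baire) (V : set baire) : nbhs x V ->
  exists n, forall y : baire, (forall i, i < n -> y i = x i) -> V y.
Proof.
pose F : set_system baire :=
  filter_from setT (fun n => [set y : baire | forall i, i < n -> y i = x i]).
have FF : Filter F.
  apply: filter_from_filter; first by exists 0.
  move=> m n _ _; exists (maxn m n) => // y yx.
  by split=> i im; apply: yx; rewrite leq_max im ?orbT.
suff : F --> x by move=> /[apply] -[n _ nV]; exists n.
apply/cvg_sup => i U [_ [[W oW <-] Wx WU]].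
apply: filterS WU _; exists i.+1 => // y yx /=.
by rewrite yx.
Qed.

Lemma baire_cylinder_open n (V : set nat) : open [set z : baire | V (z n)].
Proof.
apply: (@open_comp baire nat (fun z => z n) V) (discrete_open _) => z _.
exact: (@proj_continuous nat (fun=> nat) n z).
Qed.

(** For the Lindelof property, choose a member of the cover around each of the
countably many cylinders that fit in one. *)
Lemma baire_subspace_tychonoff_lindelof (R : realType) (D : set baire) :
  tychonoff_lindelof_space (set_type D).
Proof.
split; first split.
- exact: (@uniform_completely_regular R (set_type D)).
- move=> p q pq; apply/val_inj/funext => n.
  have cyl (t : set_type D) :
      nbhs t [set s : set_type D | (val s : baire) n = (val t : baire) n].
    apply: open_nbhs_nbhs; split=> //.
    have /continuousP := @val_continuous _ D.
    move=> /(_ [set z : baire | z n = (val t : baire) n]); apply.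
    exact: (baire_cylinder_open n [set v | v = (val t : baire) n]).
  by have [s [<- <-]] := pq _ _ (cyl p) (cyl q).
- move=> U oU covU.
  pose cyl (l : seq nat) : set (set_type D) :=
    [set s | forall i, i < size l -> (val s : baire) i = nth 0 l i].
  have pick l : exists V, (exists2 W, U W & cyl l `<=` W) -> U V /\ cyl l `<=` V.
    have [[W UW lW]|no] := pselect (exists2 W, U W & cyl l `<=` W); first by exists W.
    by exists set0 => /no.
  have [V VP] := choice pick.
  exists [set W | exists2 l, (exists2 W', U W' & cyl l `<=` W') & V l = W]; split.
  + by move=> _ [l /VP[UV _] <-].
  + apply: (card_le_trans (subset_card_le (_ : _ `<=` range V))).
      by move=> _ [l _ <-]; exists l.
    exact: card_le_trans (card_image_le _ _) (countableP _).
  + apply/seteqP; split=> // s _.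
    have : setT s by []; rewrite -covU => -[W UW Ws].
    have [W' oW' W'W] := oU W UW.
    have W's : W' (val s) by move: Ws; rewrite -W'W.
    have [n nW'] := baire_nbhs (open_nbhs_nbhs (conj oW' W's)).
    pose l := mkseq (val s : baire) n.
    have sl : cyl l s by move=> i; rewrite size_mkseq => il; rewrite nth_mkseq.
    have lW : cyl l `<=` W.
      move=> t tl; rewrite -W'W; apply: nW' => i il.
      apply: etrans (tl i _) _; first by rewrite size_mkseq.
      by rewrite nth_mkseq.
    have lW' : exists2 W, U W & cyl l `<=` W by exists W.
    have [UV lV] := VP l lW'.
    by exists (V l); [exists l|exact: lV].
Qed.

(** * Cardinals *)

Definition card_invariant (C : Type -> Prop) : Prop :=
  forall K L : Type, [set: K] #= [set: L] -> C K -> C L.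

Lemma min_cardinalE (C : Type -> Prop) (K : Type) : card_invariant C ->
  C K -> (forall L, C L -> [set: K] #<= [set: L]) ->
  min_cardinal C = (fun L => [set: K] #= [set: L]).
Proof.
move=> invC CK minK; apply/funext => L; apply/propext; split=> [[CL minL]|KL].
  by rewrite card_eq_le minK // minL.
split; first exact: invC CK.
by move=> L' /minK; apply: card_le_trans; move: KL; rewrite card_eq_le => /andP[].
Qed.

Lemma min_size_invariant (T : Type) (Phi : set (set T)) :
  card_invariant (fun K => exists2 F, Phi F & [set: K] #= F).
Proof.
move=> K L KL [F PF KF]; exists F => //.
by apply: card_eq_trans KF; rewrite card_eq_sym.
Qed.

Lemma cofinality_invariant (c : cardinal) :
  card_invariant (fun L => exists (K : Type) (r : rel K) (A : set K),
    [/\ c K, initial_well_order r, cofinal_in r A & [set: L] #= A]).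
Proof.
move=> K L KL [M [r [A [cM wr cA KA]]]]; exists M, r, A; split=> //.
by apply: card_eq_trans KA; rewrite card_eq_sym.
Qed.

Lemma add_property_invariant (C P : topologicalType -> Prop) :
  card_invariant (fun K => exists (X : topologicalType) (F : set (set X)),
    [/\ C X, [set: X] !=set0, forall A, F A -> P (set_type A),
        \bigcup_(A in F) A = setT & ~ P X /\ [set: K] #= F]).
Proof.
move=> K L KL [X [F [CX X0 PF covF [nPX KF]]]]; exists X, F; split=> //; split=> //.
by apply: card_eq_trans KF; rewrite card_eq_sym.
Qed.

(** Take any well-order [R] of [K]. If [K] embeds in a proper initial segment, pull
[R] back along an embedding into the least such segment. *)
Lemma initial_well_order_exists (K : Type) : exists r : rel K, initial_well_order r.
Proof.
have [R woR] := wochoice.well_ordering_principle {classic K}.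
have chR : wochoice.wo_chain R predT.
  by move=> A _; exact: woR.
have Rxx x : R x x by exact: (wochoice.wo_chain_reflexive chR).
have Ranti x y : R x y -> R y x -> x = y.
  by move=> xy yx; apply: (wochoice.wo_chain_antisymmetric chR); rewrite ?xy.
pose large (x : K) := [set: K] #<= [set y : K | R y x /\ y <> x].
have [[x0 lx0]|nolarge] := pselect (exists x, large x); last first.
  by exists R; split=> // x; apply/negP => lx; apply: nolarge; exists x.
have [x [[lx minx] _]] := woR (fun x => large x) (ex_intro _ x0 lx0).
have {}lx : large x by [].
have /card_leP/unsquash f := lx.
pose phi (a : K) : K := val (f (SigSub (mem_set (Logic.I : setT a)))).
have phiR a : R (phi a) x /\ phi a <> x by exact: set_valP (f _).
have phi_inj : injective phi.
  move=> a b /val_inj eq_f.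
  have := @inj _ _ setT f _ _ _ _ eq_f.
  by rewrite !inE => /(_ Logic.I Logic.I)/(congr1 val).
exists (fun a b => R (phi a) (phi b)); split.
  apply: wochoice.antisymmetric_well_order.
    by move=> a b /andP[ab ba]; apply: phi_inj; exact: Ranti.
  move=> A [a0 Aa0].
  have [|z [[/asboolP[a [Aa az]] minz] _]] :=
    woR (fun y => `[< exists a, a \in A /\ phi a = y >]).
    by exists (phi a0); apply/asboolP; exists a0.
  exists a; split=> // b Ab; rewrite az; apply: minz.
  by apply/asboolP; exists b.
move=> a; apply/negP => la.
have [Rax nax] := phiR a; apply: nax; apply: Ranti => //.
apply: minx; rewrite unfold_in /large; apply: card_le_trans la _.
pose S := [set b : K | R (phi b) (phi a) /\ b <> a].
have SE : phi @` S #= S by apply: inj_card_eq => b c _ _; exact: phi_inj.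
rewrite -[X in X #<= _]/S -(card_le_eql SE).
by apply: subset_card_le => _ [b [Rb nb] <-]; split=> // /phi_inj.
Qed.

(** Cover [Y] at even stages and [x] at odd ones. *)
Lemma selects_setU1 (X : Type) (O : set (set X)) (Y : set X) (x : X) :
  selects O Y -> selects O (Y `|` [set x]).
Proof.
move=> selY U OU covU.
have [n m|n y Yy|f fP] := selY (fun n => U n.*2).
- exact: OU.
- by apply: covU; left.
have pick n : exists m, U n m x by have [|m _] := covU n x; [right|exists m].
have [g gP] := choice pick.
exists (fun n => if odd n then g n else f n./2) => y [Yy|->] m.
  have [n mn Un] := fP y Yy m; exists n.*2.
    by apply: (leq_trans mn); rewrite -addnn leq_addr.
  by rewrite odd_double doubleK.
exists m.*2.+1; first by rewrite -addnn ltnW // ltnS leq_addr.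
by rewrite /= odd_double.
Qed.

(** An ultrafilter with no singleton contains all cofinite sets. *)
Lemma nonprincipal_infinite (U : set_system nat) (b : set nat) :
  UltraFilter U -> nonprincipal U -> U b -> infinite_set b.
Proof.
move=> ultU npU Ub finb.
have nU n : ~ U [set n].
  move=> Un; apply: (npU n); apply/seteqP; split=> A.
    move=> UA; apply/principal_filterP.
    by have [_ [/= -> An]] := filter_ex (filterI Un UA).
  by move=> /principal_filterP An; apply: filterS Un => _ ->.
have /finite_seqP[s bs] := finb.
have Us : U [set i | i \notin s].
  elim: s {bs} => [|n s IH]; first exact: filterS filterT.
  have [//|Un] := in_ultra_setVsetC [set n] ultU; first by move=> /nU.
  apply: filterS (filterI Un IH) => i [/= /eqP ni si].
  by rewrite inE negb_or ni.
have [i [bi]] := filter_ex (filterI Ub Us).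
by rewrite bs in bi; move: bi => /= ->.
Qed.

Lemma ultrafilter_lt_groupwise_density :
  cardinal_lt ultrafilter_number groupwise_density_number ->
  exists (J : Type) (B : J -> set nat), small_reaping B.
Proof.
move=> [[L [G [uL gG LG]]] neq].
have [[B [U [ultU npU [BU baseU]]] LB] minL] := uL.
have [[F [Fgd F0] GF] minG] := gG.
have nGL : ~ ([set: G] #<= [set: L]).
  move=> GL; apply: neq.
  have eqLG : [set: L] #= [set: G] by rewrite card_eq_le LG.
  rewrite /ultrafilter_number /groupwise_density_number /min_size.
  rewrite (min_cardinalE (@min_size_invariant _ _) uL.1 uL.2).
  rewrite (min_cardinalE (@min_size_invariant _ _) gG.1 gG.2).
  by apply/funext => K; apply/propext; rewrite (card_eql eqLG).
exists (set_type B), (fun j => val j); split.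
- by move=> [b /= /set_mem Bb]; apply: (nonprincipal_infinite ultU npU); exact: BU.
- move=> D gdD; apply: contrapT => noa; apply: nGL.
  have cap0 : \bigcap_(E in range D) E = set0.
    apply/seteqP; split=> // a Da; apply: noa; exists a => j.
    by apply: Da; exists j.
  have /minG : exists2 F, (F `<=` groupwise_dense /\ \bigcap_(E in F) E = set0) &
      [set: set_type (range D)] #= F.
    exists (range D); last exact: card_setT.
    by split=> // _ [j _ <-].
  move=> /card_le_trans; apply; rewrite (card_le_eql (card_setT _)).
  apply: (card_le_trans (card_image_le _ _)).
  by rewrite (card_le_eql (card_setT B)); move: LB; rewrite card_eq_le => /andP[].
- move=> W; have [/baseU[b Bb bW]|/baseU[b Bb bW]] := in_ultra_setVsetC W ultU.
    by exists (SigSub (mem_set Bb)); left.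
  by exists (SigSub (mem_set Bb)); right.
Qed.

(** A family of fewer than cov(M) spaces with S_1 is too small for its union to
lose the property, by [selects_bigcup]. *)
Lemma cov_le_add_property (R : realType) (J : Type) (B : J -> set nat) (K L : Type)
    (C : topologicalType -> Prop)
    (A : forall Z : topologicalType, set (set (set Z)))
    (O : forall Z : topologicalType, set (set Z)) :
  small_reaping B -> cov_meager R K ->
  (forall Z, set_lattice (O Z)) ->
  (forall (Z : topologicalType) (Y : set Z), S1 A A (set_type Y) -> selects (O Z) Y) ->
  (forall Z, C Z -> [set: Z] !=set0 -> selects (O Z) setT -> S1 A A Z) ->
  (exists (X : topologicalType) (F : set (set X)),
    [/\ C X, [set: X] !=set0, forall A', F A' -> S1 A A (set_type A'),
        \bigcup_(A' in F) A' = setT & ~ S1 A A X /\ [set: L] #= F]) ->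
  [set: K] #<= [set: L].
Proof.
move=> BJ covK latO S1sel selS1 [X [F [CX X0 S1F covF [nS1 LF]]]].
apply: contrapT => nKL; apply: nS1; apply: selS1 => //.
have gF : guessable (set_type F).
  apply: (not_cov_guessable covK); rewrite (card_le_eqr (card_setT F)).
  by rewrite -(card_le_eqr LF).
have := @selects_bigcup J B (set_type F) X (O X) (fun a => val a) BJ (latO X) gF.
rewrite (_ : \bigcup_i _ = setT).
  by apply=> -[a /= /set_mem Fa]; apply: S1sel; exact: S1F.
apply/seteqP; split=> // x _; have : setT x by []; rewrite -covF => -[a Fa ax].
by exists (SigSub (mem_set Fa)).
Qed.

(** * Additivity, cofinality and the covering number *)

(** The lower bound is [cov_le_add_property]; it also shows that [D] has no fewer
than cov(M) points, so that the family of its singletons has size exactly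
cov(M) and attains the bound. *)
Lemma add_S1_class (R : realType) (J : Type) (B : J -> set nat) (K : Type)
    (C : topologicalType -> Prop)
    (A : forall Z : topologicalType, set (set (set Z)))
    (O : forall Z : topologicalType, set (set Z)) (D : set baire) :
  small_reaping B -> cov_meager R K ->
  (forall Z, set_lattice (O Z)) ->
  (forall (Z : topologicalType) (Y : set Z), S1 A A (set_type Y) -> selects (O Z) Y) ->
  (forall Z, C Z -> [set: Z] !=set0 -> selects (O Z) setT -> S1 A A Z) ->
  (forall (Z : topologicalType) U, A Z U -> is_cover U) ->
  C (set_type D) -> ~ selects (O baire) D -> D #<= [set: K] ->
  add_property C (S1 A A) = (fun L => [set: K] #= [set: L]).
Proof.
move=> BJ covK latO S1sel selS1 Acov CD nselD DK.
have lower := cov_le_add_property BJ covK latO S1sel selS1.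
pose T : topologicalType := set_type D.
pose F : set (set T) := range (fun x : T => [set x]).
have T0 : [set: T] !=set0.
  apply/set0P/eqP => T0; apply: nselD => U _ _; exists id => z Dz.
  by have : [set: T] (SigSub (mem_set Dz)) by []; rewrite T0.
have S1F a : F a -> S1 A A (set_type a).
  move=> [x _ <-]; apply: (@S1_singleton A (set_type [set x])
    (SigSub (mem_set (erefl x : [set x] x)))) => [U|]; first exact: Acov.
  apply/seteqP; split=> // -[y xy] _ /=; apply: val_inj.
  by move: xy => /= /set_mem.
have covF : \bigcup_(a in F) a = setT.
  by apply/seteqP; split=> // x _; exists [set x] => //; exists x.
have nS1 : ~ S1 A A T by move=> /S1sel.
have FK : [set: set_type F] #<= [set: K].
  rewrite (card_le_eql (card_setT F)).
  apply: card_le_trans (card_image_le _ _) _.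
  by rewrite (card_le_eql (card_setT D)).
have KF : [set: K] #= F.
  rewrite -(card_eqr (card_setT F)) card_eq_le FK andbT.
  by apply: lower; exists T, F; split=> //; split=> //; exact: card_setT.
rewrite /add_property; apply: (@min_cardinalE _ K); last exact: lower.
  exact: add_property_invariant.
by exists T, F; split.
Qed.

Lemma well_order_refl (K : Type) (r : rel K) x : wochoice.well_order r -> r x x.
Proof.
move=> wo; have [|z [[/asboolP -> lb] _]] := wo (fun y => `[< y = x >]).
  by exists x; exact/asboolP.
by apply: lb; exact/asboolP.
Qed.

(** A cofinal set [A] splits [K'] into the initial segments below its points. These
have fewer than cov(M) points, up to adding the end point, so that their
images under [p] select; if [A] also had fewer than cov(M) points, the range
of [p] would select. *)
Lemma cov_le_cofinality (R : realType) (J : Type) (B : J -> set nat) (K K' L : Type)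
    (X : Type) (O : set (set X)) (p : K' -> X) (r : rel K') (A : set K') :
  small_reaping B -> cov_meager R K -> [set: K] #= [set: K'] ->
  set_lattice O -> ~ selects O (range p) ->
  initial_well_order r -> cofinal_in r A -> [set: L] #= A ->
  [set: K] #<= [set: L].
Proof.
move=> BJ covK KK' latO nsel [wo small] cofA LA.
apply: contrapT => nKL; apply: nsel.
have gA : guessable (set_type A).
  apply: (not_cov_guessable covK); rewrite (card_le_eqr (card_setT A)).
  by rewrite -(card_le_eqr LA).
have -> : range p = \bigcup_(a : set_type A) p @` [set x | r x (val a)].
  apply/seteqP; split=> [_ [x _ <-]|_ [a _ [x _ <-]]]; last by exists x.
  by have [y Ay rxy] := cofA x; exists (SigSub (mem_set Ay)) => //; exists x.
apply: (selects_bigcup BJ latO gA) => a.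
pose S := [set x | r x (val a) /\ x <> val a].
have gS : guessable (set_type S).
  apply: (not_cov_guessable covK); rewrite (card_le_eqr (card_setT S)).
  by rewrite (card_le_eql KK'); exact/negP/small.
have selS : selects O (p @` S `|` [set p (val a)]).
  apply: selects_setU1; apply: (guessable_selects (F := fun x => p (val x)) gS).
  by move=> _ [x Sx <-]; exists (SigSub (mem_set Sx)).
move=> U OU covU; have [n _ [[x Sx <-]|->]|f fP] := selS U OU.
- by apply: covU; exists x => //; case: Sx.
- by apply: covU; exists (val a) => //=; exact: well_order_refl.
exists f => _ [x rx <-]; apply: fP.
by have [->|xa] := pselect (x = val a); [right|left; exists x].
Qed.

Theorem theorem4p11 (R : realType) :
  cardinal_lt (add_null R) (cov_meager R) ->
  cardinal_le (cov_meager R) ultrafilter_number ->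
  cardinal_lt ultrafilter_number groupwise_density_number ->
  [/\ cardinal_lt (add_null R) (cofinality (cov_meager R)),
      cofinality (cov_meager R) = cov_meager R,
      cov_meager R = add_S1_open &
      add_S1_open = add_S1_borel].
Proof.
move=> addcov _ /ultrafilter_lt_groupwise_density[J [B BJ]].
have [[_ [K [_ covK _]]] _] := addcov.
have [[F [Fm Fcov] KF] minK] := covK.
have covE : cov_meager R = (fun L => [set: K] #= [set: L]).
  exact: (min_cardinalE (@min_size_invariant _ _) covK.1 covK.2).
have [p nsel] := meager_cover_not_selects BJ (open_lattice baire)
  (fun n V => baire_cylinder_open n V) Fm Fcov.
have DK : p @` F #<= [set: K].
  by rewrite (card_le_eqr KF) card_image_le.
have tyD := baire_subspace_tychonoff_lindelof R (p @` F).
have openE : add_S1_open = (fun L => [set: K] #= [set: L]).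
  apply: (add_S1_class (O := fun Z => open) BJ covK _ _ _ _ tyD nsel DK).
  - by move=> Z; exact: open_lattice.
  - by move=> Z Y; exact: open_S1_selects.
  - by move=> Z [_ lindZ] Z0; exact: open_selects_S1.
  - by move=> Z U [].
have nselB : ~ selects <<s @open baire >> (p @` F).
  move=> selB; apply: nsel => U OU; apply: selB => n m.
  by apply: (@sub_sigma_algebra baire setT open); exact: OU.
have borelE : add_S1_borel = (fun L => [set: K] #= [set: L]).
  apply: (add_S1_class (O := fun Z => <<s @open Z >>) BJ covK
    _ _ _ _ tyD.1 nselB DK).
  - by move=> Z; exact: borel_lattice.
  - by move=> Z Y; exact: borel_S1_selects.
  - by move=> Z _; exact: borel_selects_S1.
  - by move=> Z U [].
have cofE : cofinality (cov_meager R) = (fun L => [set: K] #= [set: L]).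
  rewrite /cofinality; apply: (@min_cardinalE _ K).
  - exact: cofinality_invariant.
  - have [r rP] := initial_well_order_exists K; exists K, r, setT; split=> //.
    by move=> x; exists x => //; apply: well_order_refl; case: rP.
  - move=> L [K' [r [A [covK' rP cofA LA]]]].
    have KK' : [set: K] #= [set: K'] by move: covK'; rewrite covE.
    have FK' : [set: K'] #= F.
      by apply: card_eq_trans KF; rewrite card_eq_sym.
    have /card_bijP[f [g fK gK]] := FK'.
    pose phi (k : K') := val (f (SigSub (mem_set (Logic.I : setT k)))).
    apply: (cov_le_cofinality (p := p \o phi) BJ covK KK'
      (open_lattice baire) _ rP cofA LA).
    suff -> : range (p \o phi) = p @` F by [].
    apply/seteqP; split=> [_ [k _ <-]|_ [M FM <-]].
      by exists (phi k) => //; exact: set_valP.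
    exists (val (g (SigSub (mem_set FM)))) => //=; congr (p _).
    rewrite /phi (_ : SigSub _ = g (SigSub (mem_set FM))) ?gK //.
    exact: val_inj.
by rewrite cofE openE borelE covE; split=> //; rewrite -covE.
Qed.
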